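(* Let $X$ be a Banach space and $G$ a compact topological group acting on $X$. Then $B_{X^*}$ is $w_G^*$-compact.
   Context: $X$ is a Banach space over $\mathbb{K}=\mathbb{R}$ or $\mathbb{C}$; $B_{X^*}$ is the closed unit ball of $X^*$. A compact topological group $G$ acting on $X$ means: a group $G\subseteq\mathcal{L}(X)$ of linear isometric isomorphisms of $X$ onto itself, compact for the relative topology inherited from $\mathcal{L}(X)$. $X_G=\{x\in X: g(x)=x\ \forall g\in G\}$. The weak-star group invariant topology $w_G^*=\sigma_G(X^*,X)$ is the topology on $X^*$ generated by the sets $\{f\in X^*: |\langle f-f_0,x_i\rangle|<\epsilon,\ 1\le i\le n\}$ with $f_0\in X^*$, $x_1,\dots,x_n\in X_G$, $\epsilon>0$. It need not be Hausdorff; compact means that every open cover has a finite subcover. *)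

(* Defs.v *)
From HB Require Import structures.
From mathcomp Require Import all_boot all_order all_algebra.
From mathcomp Require Import all_classical all_reals topology normedtype.
From mathcomp Require Import complex.

Set Implicit Arguments.
Unset Strict Implicit.
Unset Printing Implicit Defensive.

Import Order.TTheory GRing.Theory Num.Theory.
Import numFieldNormedType.Exports.

Local Open Scope classical_set_scope.
Local Open Scope ring_scope.

Variant scalar_kind := RealScalars | ComplexScalars.

Definition scalar_field (R : realType) (s : scalar_kind) : numFieldType :=
  if s is RealScalars then R else R[i].

Record bounded_op (K : numFieldType) (X Y : normedModType K) := BoundedOp {
  bounded_op_fun :> {linear X -> Y};
  bounded_op_continuous : continuous bounded_op_fun }.

Section BoundedOps.
Context {K : numFieldType}.
Implicit Types X Y Z : normedModType K.

HB.instance Definition _ X Y := gen_eqMixin (bounded_op X Y).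
HB.instance Definition _ X Y := gen_choiceMixin (bounded_op X Y).

Definition op_id X : bounded_op X X := @BoundedOp K X X idfun (fun=> cvg_id).

Definition op_comp X Y Z (g : bounded_op Y Z) (f : bounded_op X Y) :
    bounded_op X Z :=
  @BoundedOp K X Z (g \o f)
    (fun x => continuous_comp (@bounded_op_continuous _ _ _ f x)
                              (@bounded_op_continuous _ _ _ g (f x))).

(* [supremum] is taken in the partially ordered field K, so that the same
   formula serves real and complex scalars: in R[i] the norms are nonnegative
   reals, the upper bounds of a nonempty set of reals are real, and the
   supremum is the usual one. *)
Definition opnorm X Y (f : X -> Y) : K :=
  supremum 0 [set `|f x| | x in [set x : X | `|x| <= 1]].

Definition opnorm_balls X Y : set (set (bounded_op X Y)) :=
  [set U | exists f0 (e : K), 0 < e /\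
    U = [set f : bounded_op X Y | opnorm (fun x => f x - f0 x) < e]].

HB.instance Definition _ X Y :=
  isSubBaseTopological.Build (bounded_op X Y) (@opnorm_balls X Y) id.

Record compact_group_acting X (G : set (bounded_op X X)) : Prop := {
  acting_id : G (op_id X);
  acting_comp : forall g h, G g -> G h -> G (op_comp g h);
  acting_inv : forall g, G g -> exists2 h, G h &
    op_comp h g = op_id X /\ op_comp g h = op_id X;
  acting_isometry : forall g, G g -> forall x, `|g x| = `|x|;
  acting_onto : forall g, G g -> forall y, exists x, g x = y;
  acting_compact : cover_compact G }.

Definition fixed_points X (G : set (bounded_op X X)) : set X :=
  [set x | forall g, G g -> g x = x].

Definition dual X := bounded_op X K^o.

Definition dual_unit_ball X : set (dual X) := [set f | opnorm f <= 1].

(* The dual space carrying the topology w*_G; [dual X] itself carries the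
   operator norm topology. *)
Definition wstar_dual X (G : set (bounded_op X X)) : Type := dual X.

Definition wstar_subbase X (G : set (bounded_op X X)) :
    set (set (wstar_dual G)) :=
  [set U | exists (f0 : dual X) (xs : seq X) (e : K),
    [/\ forall x, x \in xs -> fixed_points G x, 0 < e &
      U = [set f : dual X | forall x, x \in xs -> `|f x - f0 x| < e]]].

HB.instance Definition _ X (G : set (bounded_op X X)) :=
  Choice.copy (wstar_dual G) (dual X).
HB.instance Definition _ X (G : set (bounded_op X X)) :=
  isSubBaseTopological.Build (wstar_dual G) (@wstar_subbase X G) id.

End BoundedOps.

Arguments dual {K} X.
Arguments dual_unit_ball {K} X.

(* Main.v *)
(* The topology w*_G is coarser than the weak-star topology, so the
   Banach-Alaoglu argument applies: along an ultrafilter on the dual unit ball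
   each evaluation f x stays in the compact disc of radius |x|, hence converges,
   and the pointwise limit is linear and bounded by |x|, so it is a limit of the
   ultrafilter in the ball. *)
Require Import Defs.
From HB Require Import structures.
From mathcomp Require Import all_boot all_order all_algebra.
From mathcomp Require Import all_classical all_reals topology normedtype.
From mathcomp Require Import complex.

Set Implicit Arguments.
Unset Strict Implicit.
Unset Printing Implicit Defensive.

Import Order.TTheory GRing.Theory Num.Theory.
Import numFieldNormedType.Exports.

Local Open Scope classical_set_scope.

(** If A is in [H] but its preimage is not in [F], then [F] being ultra puts the complement of A in
    [H] as well, which is absurd. *)
Lemma ultra_fmap (T U : Type) (f : T -> U) (F : set_system T) :
  UltraFilter F -> UltraFilter (f @ F).
Proof.
move=> FU; apply: Build_UltraFilter => H HF FH.
rewrite eqEsubset; split=> // A HA.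
case: (in_ultra_setVsetC (f @^-1` A) FU) => // FA.
have HnA : H (~` A) by apply: FH.
have [x [Ax nAx]] := filter_ex (filterI HA HnA).
by [].
Qed.

Section NormedScalars.
Context {K : numFieldType}.
Local Open Scope ring_scope.

(* [opnorm] takes the junk value 0 on a set without supremum; the order of an
   abstract [numFieldType] being partial and possibly incomplete, the existence
   of suprema of norms is made a hypothesis on the scalars. *)
Definition has_norm_suprema := forall A : set K, A !=set0 ->
  (forall a, A a -> 0 <= a) -> ubound A !=set0 -> supremums A !=set0.

(** Together with [has_norm_suprema], this lets real and complex scalars share one argument. *)
Definition has_compact_discs :=
  forall r : K, 0 <= r -> compact [set z : K^o | `|z| <= r].

Variable X : normedModType K.

Lemma opnorm_le1 (f : X -> K^o) :
  (forall x, `|f x| <= `|x|) -> opnorm f <= 1.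
Proof.
move=> fle; rewrite /opnorm /supremum; case: ifP => _; first exact: ler01.
case: xgetP => [s _ [_ sleast]|_]; last exact: ler01.
by apply: sleast => _ [x /= x1 <-]; exact: le_trans (fle x) x1.
Qed.

(** Continuity bounds [f] on the unit ball, so [opnorm f] is a true supremum and not a default
    value. *)
Lemma norm_le_opnorm (f : bounded_op X K^o) (x : X) : has_norm_suprema ->
  `|x| <= 1 -> `|f x| <= opnorm f.
Proof.
move=> Ksup x1; rewrite /opnorm /supremum.
set A := [set `|f y| | y in [set y : X | `|y| <= 1]].
have Afx : A `|f x| by exists x.
have [A0|_] := eqVneq A set0; first by move: Afx; rewrite A0.
suff /(xgetPex 0) [Aub _] : supremums A !=set0 by exact: Aub.
apply: Ksup; [by exists `|f x| | by move=> _ [y _ <-] |].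
have /bounded_funP/(_ 1) [M fM] : bounded_near f (nbhs (0 : X)).
  exact/linear_bounded_continuous/bounded_op_continuous.
by exists M => _ [y /= y1 <-]; exact: fM.
Qed.

(** Rescale to norm 1. Unlike [opnorm], the pointwise bounds pass directly to pointwise limits. *)
Lemma dual_unit_ballP (f : dual X) : has_norm_suprema ->
  dual_unit_ball X f <-> forall x, `|f x| <= `|x|.
Proof.
move=> Ksup; split; last exact: opnorm_le1.
move=> f1 x; have [->|x0] := eqVneq x 0; first by rewrite linear0 !normr0.
have nx0 : `|x| != 0 by rewrite normr_eq0.
have u1 : `|(`|x|)^-1 *: x| <= 1 by rewrite normrZ normfV normr_id mulVf.
have := le_trans (norm_le_opnorm f Ksup u1) f1.
rewrite linearZ/= normrZ normfV normr_id.
by rewrite ler_pdivrMl ?mulr1// normr_gt0.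
Qed.

(* Convergence is assumed at every point, not only on [fixed_points G]: w*_G is
   coarser than the weak-star topology. *)
Lemma cvg_wstar (G : set (bounded_op X X)) (F : set_system (wstar_dual G))
    (L : wstar_dual G) : Filter F ->
  (forall x, (fun f : wstar_dual G => (f : dual X) x : K^o) @ F
               --> ((L : dual X) x : K^o)) ->
  F --> L.
Proof.
(* An open set is a union of finite intersections of subbasic sets, so it suffices that [F] contains
   each subbasic set around [L]. *)
move=> FF FL A; rewrite nbhsE => -[_ [[B sB <-] [C BC CL]] sUA].
apply: filterS sUA _; apply: (@filterS _ _ _ C); first by move=> ? ?; exists C.
have /sB [D sD IDC] := BC; rewrite -IDC; apply: filter_bigI => E DE.
have := sD _ DE; rewrite inE => -[f0 [xs [e [_ e0 EE]]]].
have : E L by move: CL; rewrite -IDC => /(_ _ DE).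
rewrite /= EE /= => EL {E EE DE}.
elim: xs EL => [|x xs IH] EL.
  by apply: filterS filterT => f _ y; rewrite in_nil.
have {}IH := IH (fun y yxs => EL y (mem_behead (s := x :: xs) yxs)).
have /cvgrPdist_lt Lx := FL x.
(* This slack of [L x] inside the disc of radius [e] about [f0 x] is how far [f x] may stray from
   [L x]. *)
have d0 : 0 < e - `|(L : dual X) x - f0 x|.
  by rewrite subr_gt0; apply: EL; rewrite mem_head.
apply: filterS (filterI (Lx _ d0) IH) => f [/= fx fxs] y.
rewrite in_cons => /orP[/eqP ->|]; last exact: fxs.
rewrite -(subrKA ((L : dual X) x)) (le_lt_trans (ler_normD _ _))//.
by rewrite distrC -ltrBrDr.
Qed.

(** Linearity comes from uniqueness of limits in [K], continuity from the bound by the norm. *)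
Lemma dual_pointwise_limit (T : Type) (F : set_system T)
    (u : T -> dual X) (l : X -> K^o) : ProperFilter F ->
  (forall x, (fun t => u t x : K^o) @ F --> l x) ->
  (forall x, `|l x| <= `|x|) ->
  exists L : dual X, forall x, L x = l x.
Proof.
move=> FF Fl lle.
have lP : linear l.
  move=> a x y.
  apply: (@cvg_unique _ (@norm_hausdorff _ K^o)
    ((fun t => u t (a *: x + y) : K^o) @ F)).
    exact: Fl.
  rewrite (_ : (fun t => _) = (fun t => a *: (u t x : K^o) + (u t y : K^o))).
    by apply: cvgD (Fl y); apply: cvgZl_tmp (Fl x).
  by apply/funext => t; rewrite linearP.
pose lA := GRing.isLinear.Build K X K^o *:%R l lP.
pose lL : {linear X -> K^o} := HB.pack l lA.
have lc : continuous lL.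
  apply/linear_bounded_continuous/bounded_funP => r; exists r => x.
  exact: le_trans (lle x).
by exists (BoundedOp lc).
Qed.

(** Serves as base point: [compact_cover] is applied to a pointed space. *)
Definition dual_zero : dual X :=
  @BoundedOp K X K^o (\0 : {linear X -> K^o}) (fun x => cvg_cst (0 : K^o)).

HB.instance Definition _ (G : set (bounded_op X X)) :=
  isPointed.Build (wstar_dual G) dual_zero.

Lemma banach_alaoglu (G : set (bounded_op X X)) :
  has_norm_suprema -> has_compact_discs ->
  compact (dual_unit_ball X : set (wstar_dual G)).
Proof.
move=> Ksup Kdisc; rewrite compact_ultra => F FU FB.
have limP x : exists l : K^o, `|l| <= `|x| /\
    (fun f : wstar_dual G => (f : dual X) x : K^o) @ F --> l.
  have := Kdisc `|x| (normr_ge0 x); rewrite compact_ultra.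
  move=> /(_ _ (ultra_fmap (fun f : wstar_dual G => (f : dual X) x : K^o) FU)).
  case; last by move=> l [lx Fl]; exists l.
  have FB' : F [set f : wstar_dual G | `|(f : dual X) x| <= `|x|].
    by apply: filterS FB => f fB; exact: (dual_unit_ballP (f : dual X) Ksup).1.
  exact: FB'.
have /choice[l lP] := limP.
have [] := @dual_pointwise_limit _ F id l _.
- by move=> x; have [] := lP x.
- by move=> x; have [] := lP x.
move=> L LE; exists L; split.
  by apply/(dual_unit_ballP _ Ksup) => x; rewrite LE; have [] := lP x.
by apply: cvg_wstar => x; rewrite LE; have [] := lP x.
Qed.

End NormedScalars.

Section Reals.
Variable R : realType.
Local Open Scope complex_scope.
Local Open Scope ring_scope.

Lemma real_has_norm_suprema : @has_norm_suprema R.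
Proof.
move=> A A0 _ Aub; have Asup : has_sup A by [].
exists (sup A); split; first exact: sup_upper_bound.
by move=> y yA; exact: ge_sup.
Qed.

Lemma real_has_compact_discs : @has_compact_discs R.
Proof.
move=> r _; rewrite (_ : [set z : R^o | _] = `[- r, r]%classic).
  exact: segment_compact.
by apply/funext => z; rewrite /= in_itv /= ler_norml.
Qed.

Lemma complex_has_norm_suprema : @has_norm_suprema R[i].
Proof.
move=> A [a0 Aa0] Age0 [b bA].
have AE a : A a -> a = (complex.Re a)%:C.
  by move=> /Age0 /ger0_real /RRe_real.
have ReA : has_sup [set complex.Re a | a in A].
  split; first by exists (complex.Re a0), a0.
  by exists (complex.Re b) => _ [a /bA + <-]; rewrite lecE => /andP[].
exists (sup [set complex.Re a | a in A])%:C; split.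
  move=> a Aa; rewrite (AE _ Aa) lecR; apply: sup_upper_bound => //.
  by exists a.
(* [u] lies above [a0], which is nonnegative, so [u] is real and comparing real parts suffices. *)
move=> u uA; have uE : u = (complex.Re u)%:C.
  by apply/esym/RRe_real/ger0_real/(le_trans (Age0 _ Aa0))/uA.
rewrite uE lecR; apply: ge_sup; first by case: ReA.
by move=> _ [a /uA + <-]; rewrite lecE => /andP[].
Qed.

Lemma complex_norm_le (z : R[i]) :
  `|z| <= (`|complex.Re z| + `|complex.Im z|)%:C.
Proof.
(* With the right side written as the root of its square, the radicands differ by twice the product
   of |Re z| and |Im z|. *)
rewrite normc_def lecR -[leRHS]ger0_norm ?addr_ge0// -sqrtr_sqr.
rewrite ler_sqrt ?sqr_ge0// sqrrD !real_normK ?num_real//.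
by rewrite lerD2r lerDl mulrn_wge0// mulr_ge0.
Qed.

Lemma ler_Re_Im_norm (z : R[i]) :
  `|complex.Re z|%:C <= `|z| /\ `|complex.Im z|%:C <= `|z|.
Proof.
by rewrite normc_def !lecR -!sqrtr_sqr !ler_sqrt ?addr_ge0 ?sqr_ge0//
  lerDl lerDr !sqr_ge0.
Qed.

(** Limits of the real and imaginary parts, found in a compact real segment, combine into a limit in
    [R[i]]. *)
Lemma complex_has_compact_discs : @has_compact_discs R[i].
Proof.
move=> r r0; rewrite compact_ultra => F FU Fr.
have rE : r = (complex.Re r)%:C by apply/esym/RRe_real/ger0_real.
have cvg_part (p : R[i] -> R) : (forall z, `|p z|%:C <= `|z|) ->
    exists l : R, p @ F --> l.
  move=> ple; have r0' : 0 <= complex.Re r by rewrite -ler0c -rE.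
  have := real_has_compact_discs r0'; rewrite compact_ultra.
  move=> /(_ _ (ultra_fmap p FU)) [|l [_ pl]]; last by exists l.
  have Fp : F [set z | `|p z| <= complex.Re r].
    apply: filterS Fr => z /= zr; rewrite -lecR -rE.
    exact: le_trans (ple z) zr.
  exact: Fp.
have [a Fa] := cvg_part _ (fun z => (ler_Re_Im_norm z).1).
have [b Fb] := cvg_part _ (fun z => (ler_Re_Im_norm z).2).
have Fab : F --> ((a +i* b)%C : R[i]^o).
  apply/cvgrPdist_lt => e e0.
  have eE : e = (complex.Re e)%:C by apply/esym/RRe_real/gtr0_real.
  have e0' : 0 < complex.Re e / 2 by rewrite divr_gt0// -ltcR -eE.
  move/cvgrPdist_lt : Fa => /(_ _ e0') Fa.
  move/cvgrPdist_lt : Fb => /(_ _ e0') Fb.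
  apply: filterS (filterI Fa Fb) => -[x y] [/= ax by_].
  apply: le_lt_trans (complex_norm_le _) _.
  by rewrite eE ltcR [ltRHS]splitr ltrD.
exists (a +i* b)%C; split=> //=.
(* The disc is closed: a limit of norm above [r] would force norms above [r] along [F]. *)
rewrite real_leNgt ?normr_real ?ger0_real//; apply/negP => rab.
have Frz : F [set z : R[i]^o | r < `|z|] by exact: cvgr_norm_gt Fab _ rab.
have [z [/= rz]] := filter_ex (filterI Frz Fr).
by rewrite real_leNgt ?normr_real ?ger0_real// rz.
Qed.

End Reals.

Theorem theorem7 (R : realType) (s : scalar_kind)
    (X : completeNormedModType (scalar_field R s)) (G : set (bounded_op X X))
    (hG : compact_group_acting G) :
  cover_compact (dual_unit_ball X : set (wstar_dual G)).
Proof.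
rewrite -[cover_compact _]/(@cover_compact (wstar_dual G : ptopologicalType) _).
rewrite -compact_cover; apply: banach_alaoglu.
- by case: s {X G hG}; [exact: real_has_norm_suprema
                       |exact: complex_has_norm_suprema].
- by case: s {X G hG}; [exact: real_has_compact_discs
                       |exact: complex_has_compact_discs].
Qed.
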